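(* For the Conway triple $\mathcal{L}_+=4_1$ (figure-eight knot), $\mathcal{L}_-=$ the unknot with two negative kinks, and $\mathcal{L}_0=T(2,-2)$ with one positive kink, the congruence $$\check{\mathcal{Z}}_{p}(\mathcal{L}_+;q,t)-\check{\mathcal{Z}}_{p}(\mathcal{L}_-;q,t)\equiv(-1)^{p-1}\check{\mathcal{Z}}_{p}(\mathcal{L}_0;q,t)\mod\{p\}^2$$ holds for $p=2$ and $p=3$.
   Context: Links are oriented and framed, represented by planar diagrams with the blackboard framing (diagrams up to Reidemeister moves II and III). Put $z=q-q^{-1}$, $[d]=q^d-q^{-d}$, $\{d\}=[d]/[1]$, and let $\Lambda=\mathbb{Q}[q^{\pm1},t^{\pm1}]$ with the elements $q^k-q^{-k}$ ($k\ge1$) inverted. A Conway triple $(\mathcal{L}_+,\mathcal{L}_-,\mathcal{L}_0)$ is a triple of oriented diagrams identical except near one point, where they have a positive crossing, a negative crossing, and the oriented smoothing respectively. Here $4_1$ has its standard four-crossing diagram (writhe $0$), the unknot with two negative kinks has writhe $-2$, and $T(2,-2)$ is the closure of the $2$-braid $\sigma_1^{-2}$ (strands oriented in parallel), to one component of which a positive kink is added. Framed HOMFLY-PT polynomial: $\mathcal{H}(\mathcal{L};q,t)\in\Lambda$ is the framed link invariant determined by: $\mathcal{H}=1$ for the empty diagram, $\mathcal{H}(U)=\frac{t-t^{-1}}{q-q^{-1}}$ for the $0$-framed unknot $U$ (and a disjoint such $U$ multiplies $\mathcal{H}$ by this scalar); $\mathcal{H}(\mathcal{L}_+)-\mathcal{H}(\mathcal{L}_-)=z\,\mathcal{H}(\mathcal{L}_0)$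 for every Conway triple; adding a positive (resp. negative) kink multiplies $\mathcal{H}$ by $t$ (resp. $t^{-1}$). Skein of the annulus: $\mathcal{C}$ is the $\Lambda$-module of linear combinations of oriented link diagrams in the annulus modulo the same local relations. For $i,j\ge 0$ let $A_{i,j}\in\mathcal{C}$ be the closure of the braid $\sigma_{i+j}\cdots\sigma_{j+1}\sigma_j^{-1}\cdots\sigma_1^{-1}$ on $i+j+1$ strands, oriented along the core ($\sigma_i$ positive crossings). For $m\ge1$ define $P_m$ by $[m]P_m=z\sum_{i=0}^{m-1}A_{i,m-1-i}$. Decoration: for $\mathcal{L}$ with components $\mathcal{K}_1,\dots,\mathcal{K}_L$ and $T_\alpha\in\mathcal{C}$, $\mathcal{L}\star\otimes_{\alpha=1}^L T_\alpha$ is obtained by replacing the (framing) annulus around each $\mathcal{K}_\alpha$ by the annulus containing $T_\alpha$, core orientations matching, extended multilinearly. For a link $\mathcal{L}$ with $L$ components and $p\ge1$, $\check{\mathcal{Z}}_p(\mathcal{L};q,t)=[p]^L\,\mathcal{H}(\mathcal{L}\star\otimes_{\alpha=1}^LP_p)$. The notation $A\equiv B\mod C$ means $\frac{A-B}{C}\in\mathbb{Z}[(q-q^{-1})^2,t^{\pm1}]$. *)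

(* Defs.v *)
From mathcomp Require Import all_boot all_order all_algebra.

Set Implicit Arguments.
Unset Strict Implicit.
Unset Printing Implicit Defensive.

Import GRing.Theory.

(* A planar diagram is cut by horizontal lines into elementary slices and read
   from bottom to top.  A level is the sequence of the orientations of the
   strands met by a line, from left to right, [true] meaning upwards.  Positions
   count from 0:
   - [Cup i c] creates strands i and i+1, oriented c and ~~ c;
   - [Cap i] joins strands i and i+1, which must have opposite orientations;
   - [Cross i o] exchanges strands i and i+1; the strand going from the bottom
     left to the top right is the over-strand iff [o]. *)
Inductive slice :=
  | Cup of nat & bool
  | Cap of nat
  | Cross of nat & bool.

Definition diagram := seq slice.

(* Passing the slice [x] in a sequence of data attached to the strands; [l] and
   [r] are the data of the two legs if [x] is a cup. *)
Definition evolve (T : Type) (l r : T) (s : seq T) (x : slice) : seq T :=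
  match x with
  | Cup i _ => take i s ++ l :: r :: drop i s
  | Cap i => take i s ++ drop i.+2 s
  | Cross i _ => take i s ++ rev (take 2 (drop i s)) ++ drop i.+2 s
  end.

Definition fits (s : seq bool) (x : slice) : bool :=
  match x with
  | Cup i _ => i <= size s
  | Cap i => (i.+1 < size s) && (nth false s i != nth false s i.+1)
  | Cross i _ => i.+1 < size s
  end.

Definition step (s : seq bool) (x : slice) : seq bool :=
  let c := if x is Cup _ c then c else true in evolve c (~~ c) s x.

Fixpoint valid (s : seq bool) (w : diagram) : bool :=
  if w is x :: w' then fits s x && valid (step s x) w' else true.

Definition level (s : seq bool) (w : diagram) : seq bool := foldl step s w.

Definition is_tangle (s : seq bool) (w : diagram) (s' : seq bool) : bool :=
  valid s w && (level s w == s').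

Definition is_link (w : diagram) : bool := is_tangle [::] w [::].

Definition pos (x : slice) : nat :=
  match x with Cup i _ => i | Cap i => i | Cross i _ => i end.

Definition arity_in (x : slice) : nat := if x is Cup _ _ then 0 else 2.
Definition arity_out (x : slice) : nat := if x is Cap _ then 0 else 2.

Definition shift (d : nat) (x : slice) : slice :=
  match x with
  | Cup i c => Cup (d + i) c
  | Cap i => Cap (d + i)
  | Cross i o => Cross (d + i) o
  end.

(* The first five moves generate planar isotopy: sliding distant slices past
   each other, straightening a strand, and turning a crossing around a local
   extremum.  In [R3] the strands are A, B, C from left to right at the bottom,
   and o1, o2, o3 say whether A is over B, A over C, B over C; the two excluded
   cases are those where "over" is cyclic. *)
Inductive move : diagram -> diagram -> Prop :=
  | Exchange x y : pos x <= pos y ->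
      move [:: x; shift (arity_out x) y] [:: shift (arity_in x) y; x]
  | ZigzagL i c : move [:: Cup i c; Cap i.+1] [::]
  | ZigzagR i c : move [:: Cup i.+1 c; Cap i] [::]
  | TurnCap i o : move [:: Cross i o; Cap i.+1] [:: Cross i.+1 (~~ o); Cap i]
  | TurnCup i c o :
      move [:: Cup i c; Cross i.+1 o] [:: Cup i.+1 c; Cross i (~~ o)]
  | R2 i o : move [:: Cross i o; Cross i (~~ o)] [::]
  | R3 i o1 o2 o3 : ~~ ((o1 == o3) && (o2 != o1)) ->
      move [:: Cross i o1; Cross i.+1 o2; Cross i o3]
           [:: Cross i.+1 o3; Cross i o2; Cross i.+1 o1].

(* Equality of framed oriented links: planar isotopy and Reidemeister moves II
   and III, in which every intermediate word is a link diagram. *)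
Inductive isotopic : diagram -> diagram -> Prop :=
  | isotopic_move u v l r : move l r ->
      is_link (u ++ l ++ v) -> is_link (u ++ r ++ v) ->
      isotopic (u ++ l ++ v) (u ++ r ++ v)
  | isotopic_refl w : isotopic w w
  | isotopic_sym w w' : isotopic w w' -> isotopic w' w
  | isotopic_trans w1 w2 w3 :
      isotopic w1 w2 -> isotopic w2 w3 -> isotopic w1 w3.

(* If the strands below a crossing are oriented a and b, then [Cross i o] is
   positive iff o = (a == b), and the oriented smoothing is trivial if a = b
   and a cap followed by a cup otherwise. *)
Inductive conway_triple : diagram -> diagram -> diagram -> Prop :=
  ConwayTriple u v i :
    let a := nth false (level [::] u) i in
    let b := nth false (level [::] u) i.+1 in
    is_link (u ++ Cross i (a == b) :: v) ->
    conway_triple (u ++ Cross i (a == b) :: v)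
                  (u ++ Cross i (a != b) :: v)
                  (u ++ (if a == b then [::] else [:: Cap i; Cup i b]) ++ v).

(* A curl to the left or to the right of strand i, which is oriented a; both
   strands at the crossing are then oriented a, so its sign is given by o. *)
Definition kink (left : bool) (i : nat) (a o : bool) : diagram :=
  if left then [:: Cup i (~~ a); Cross i.+1 o; Cap i]
  else [:: Cup i.+1 a; Cross i o; Cap i.+1].

(* A diagram in the annulus, cut along a radius: [body] is a tangle from [ends]
   to [ends], and the core of the annulus is oriented upwards. *)
Record annular := Annular { ends : seq bool; body : diagram }.

Definition is_annular (A : annular) : bool :=
  is_tangle (ends A) (body A) (ends A).

Fixpoint cups (i : nat) (s : seq bool) : diagram :=
  if s is c :: s' then Cup i c :: cups i.+1 s' else [::].

Definition caps (i n : nat) : diagram := [seq Cap k | k <- rev (iota i n)].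

Definition closure (A : annular) : diagram :=
  cups 0 (ends A) ++ body A ++ caps 0 (size (ends A)).

Definition sigma (k : nat) : slice := Cross k.-1 true.
Definition sigmaV (k : nat) : slice := Cross k.-1 false.

Definition A_ (i j : nat) : annular :=
  Annular (nseq (i + j).+1 true)
          ([seq sigma k | k <- rev (iota j.+1 i)] ++
           [seq sigmaV k | k <- rev (iota 1 j)]).

(* The cups of a diagram are numbered from 0 in order of appearance, and a
   component is denoted by the least number of its cups.  [joined] lists the
   pairs of cups whose legs are joined by a cap, and [component w] maps a cup to
   its component. *)
Definition is_cup (x : slice) : bool := if x is Cup _ _ then true else false.

Fixpoint joined (n : nat) (s : seq nat) (w : diagram) : seq (nat * nat) :=
  if w is x :: w' then
    (if x is Cap i then [:: (nth 0 s i, nth 0 s i.+1)] else [::])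
      ++ joined (n + is_cup x) (evolve n n s x) w'
  else [::].

Definition merge_classes (r : seq nat) (e : nat * nat) : seq nat :=
  let a := nth 0 r e.1 in
  let b := nth 0 r e.2 in
  [seq if c == maxn a b then minn a b else c | c <- r].

Definition component (w : diagram) : seq nat :=
  foldl merge_classes (iota 0 (count is_cup w)) (joined 0 [::] w).

Definition components (w : diagram) : seq nat := undup (component w).

(* Blackboard cabling.  A strand is a pair (orientation, component).  A strand
   of the component k oriented upwards becomes [ends (T k)]; oriented downwards
   it is seen rotated by a half turn.  The pattern [body (T k)] is inserted once
   on each component, on the upward leg of its first cup. *)
Definition bundle (T : nat -> annular) (e : bool * nat) : seq bool :=
  if e.1 then ends (T e.2) else rev (map negb (ends (T e.2))).

Definition grid (i m n : nat) (o : bool) : diagram :=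
  flatten [seq [seq Cross k o | k <- iota j n] | j <- rev (iota i m)].

Fixpoint cable (T : nat -> annular) (cmp : seq nat) (n : nat)
    (s : seq (bool * nat)) (w : diagram) : diagram :=
  if w is x :: w' then
    let width e := size (bundle T e) in
    let offset i := sumn [seq width e | e <- take i s] in
    let strand i := nth (true, 0) s i in
    let k := nth 0 cmp n in
    let c := if x is Cup _ c then c else true in
    match x with
    | Cup i _ =>
        cups (offset i) (bundle T (c, k)) ++
        (if k == n then
           [seq shift (offset i + (if c then 0 else width (c, k))) y
              | y <- body (T k)]
         else [::])
    | Cap i => caps (offset i) (width (strand i))
    | Cross i o => grid (offset i) (width (strand i)) (width (strand i.+1)) o
    end ++ cable T cmp (n + is_cup x) (evolve (c, k) (~~ c, k) s x) w'
  else [::].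

Definition decorate (w : diagram) (T : nat -> annular) : diagram :=
  cable T (component w) 0 [::] w.

Local Open Scope ring_scope.

(* The field Q(q, t), which contains Lambda. *)
Definition K : fieldType := {fraction {poly {poly rat}}}.

Definition q : K := tofrac ('X%:P : {poly {poly rat}}).
Definition t : K := tofrac ('X : {poly {poly rat}}).
Definition z : K := q - q^-1.

Definition br (d : nat) : K := q ^+ d - q ^- d.
Definition qint (d : nat) : K := br d / br 1.

Definition in_Lambda (x : K) : Prop :=
  exists (f : {poly {poly rat}}) (m n : nat) (ks : seq nat),
    all (leq 1) ks /\
    x * (q ^+ m * t ^+ n * \prod_(k <- ks) br k) = tofrac f.

(* The subring Z[(q - q^-1)^2, t^{+-1}]. *)
Definition in_Zz2t (x : K) : Prop :=
  exists (a : nat -> nat -> int) (m n d : nat),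
    x * t ^+ d = \sum_(i < m) \sum_(j < n) (a i j)%:~R * z ^+ (2 * i) * t ^+ j.

Definition congr_mod (A B C : K) : Prop := in_Zz2t ((A - B) / C).

(* The defining properties of the framed HOMFLY-PT polynomial; the values of
   [H] on words that are not link diagrams are irrelevant. *)
Record framed_homfly (H : diagram -> K) : Prop := FramedHomfly {
  homfly_Lambda : forall w, is_link w -> in_Lambda (H w);
  homfly_isotopic : forall w w', isotopic w w' -> H w = H w';
  homfly_empty : H [::] = 1;
  homfly_circle : forall u v i c, is_link (u ++ [:: Cup i c; Cap i] ++ v) ->
    H (u ++ [:: Cup i c; Cap i] ++ v) = (t - t^-1) / (q - q^-1) * H (u ++ v);
  homfly_skein : forall Lp Lm L0, conway_triple Lp Lm L0 ->
    H Lp - H Lm = z * H L0;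
  homfly_kink : forall u v left i a o, is_link (u ++ kink left i a o ++ v) ->
    H (u ++ kink left i a o ++ v) = (if o then t else t^-1) * H (u ++ v)
}.

(* Formal Lambda-linear combinations representing elements of the skein of the
   annulus.  The skein itself is the quotient by the relations satisfied by [H];
   the value of [H] on a decorated link only depends on the classes. *)
Definition skein := seq (K * annular).

Definition P_ (m : nat) : skein :=
  [seq (z / br m, A_ i (m - 1 - i)%N) | i <- iota 0 m].

(* The components in [ks] remain to be decorated, the others by [T]. *)
Fixpoint decorate_rec (w : diagram) (X : nat -> skein) (ks : seq nat)
    (T : nat -> annular) : seq (K * diagram) :=
  if ks is k :: ks' then
    flatten [seq [seq (a.1 * b.1, b.2)
                    | b <- decorate_rec w X ks'
                             (fun l => if l == k then a.2 else T l)]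
               | a <- X k]
  else [:: (1, decorate w T)].

(* L * (X_1 (x) ... (x) X_L), a linear combination of link diagrams. *)
Definition decorate_skein (w : diagram) (X : nat -> skein) :
    seq (K * diagram) :=
  decorate_rec w X (components w) (fun=> Annular [::] [::]).

Definition linear_extension (H : diagram -> K) (x : seq (K * diagram)) : K :=
  \sum_(a <- x) a.1 * H a.2.

Definition Zcheck (H : diagram -> K) (p : nat) (w : diagram) : K :=
  br p ^+ size (components w) *
  linear_extension H (decorate_skein w (fun=> P_ p)).

Local Close Scope ring_scope.

Definition figure_eight : diagram :=
  closure (Annular (nseq 3 true) [:: sigmaV 1; sigma 2; sigmaV 1; sigma 2]).

Definition unknot_two_negative_kinks : diagram :=
  closure (Annular [:: true] (kink false 0 true false ++
                              kink false 0 true false)).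

Definition torus_link_positive_kink : diagram :=
  closure (Annular (nseq 2 true) ([:: sigmaV 1; sigmaV 1] ++
                                  kink false 1 true true)).

(* The last two diagrams are isotopic to those obtained from [figure_eight] by
   switching and smoothing its first positive crossing. *)
Definition figure_eight_switched : diagram :=
  closure (Annular (nseq 3 true) [:: sigmaV 1; sigmaV 2; sigmaV 1; sigma 2]).

Definition figure_eight_smoothed : diagram :=
  closure (Annular (nseq 3 true) [:: sigmaV 1; sigmaV 1; sigma 2]).

Lemma figure_eight_conway :
  conway_triple figure_eight figure_eight_switched figure_eight_smoothed.
Proof.
exact: (@ConwayTriple [:: Cup 0 true; Cup 1 true; Cup 2 true; Cross 0 false]
          [:: Cross 0 false; Cross 1 true; Cap 2; Cap 1; Cap 0] 1 isT).
Qed.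

Lemma isotopic_via (k : nat) (w w' l r : diagram)
    (lr : move l r \/ move r l) :
    w = take k w ++ l ++ drop (k + size l) w ->
    is_link w -> is_link (take k w ++ r ++ drop (k + size l) w) ->
    isotopic (take k w ++ r ++ drop (k + size l) w) w' ->
  isotopic w w'.
Proof.
set u := take k w; set v := drop _ w => -> Lw Lw'; apply: isotopic_trans.
case: lr => m; first exact: isotopic_move.
by apply: isotopic_sym; exact: isotopic_move.
Qed.

Lemma figure_eight_switched_isotopic :
  isotopic figure_eight_switched unknot_two_negative_kinks.
Proof.
apply: (isotopic_via (k := 2)
  (or_intror (Exchange (x := Cross 0 false) (y := Cup 0 true) isT))) => //=.
apply: (isotopic_via (k := 3) (or_intror (TurnCup 1 true true))) => //=.
apply: (isotopic_via (k := 6) (or_introl (TurnCap 1 true))) => //=.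
apply: (isotopic_via (k := 4)
  (or_intror (Exchange (x := Cross 0 false) (y := Cross 0 true) isT))) => //=.
apply: (isotopic_via (k := 5) (or_introl (R2 2 true))) => //=.
apply: (isotopic_via (k := 5)
  (or_introl (Exchange (x := Cap 1) (y := Cap 1) isT))) => //=.
apply: (isotopic_via (k := 4)
  (or_introl (Exchange (x := Cross 0 false) (y := Cap 1) isT))) => //=.
apply: (isotopic_via (k := 3)
  (or_introl (Exchange (x := Cup 1 true) (y := Cap 1) isT))) => //=.
exact: isotopic_refl.
Qed.

Lemma figure_eight_smoothed_isotopic :
  isotopic figure_eight_smoothed torus_link_positive_kink.
Proof.
apply: (isotopic_via (k := 2)
  (or_intror (Exchange (x := Cross 0 false) (y := Cup 0 true) isT))) => //=.
apply: (isotopic_via (k := 3)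
  (or_intror (Exchange (x := Cross 0 false) (y := Cup 0 true) isT))) => //=.
exact: isotopic_refl.
Qed.

(* Main.v *)
Require Import Defs.
From Stdlib Require Import BinInt.
From mathcomp Require Import all_boot all_order all_algebra.
From mathcomp Require Import ssrZ ring.
Import GRing.Theory.

(* Read from bottom to top, every decorated diagram is built from n parallel
   upward strands closed on their right: a cup adds a strand, a crossing is a
   generator of the Hecke algebra H_n, and a cap closes the last strand, which
   acts on H_n as the Markov trace H_n -> H_(n-1).  Hence the skein relations
   compute H on these diagrams by linear algebra in the normal form basis of
   H_n.  Multiplied by a power of t z, the values are polynomials in z and t^2
   over Z, and the congruence is the divisibility of one explicit polynomial by
   {2}^2 = z^2 + 4, respectively {3}^2 = (z^2 + 3)^2. *)

Set Implicit Arguments.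
Unset Strict Implicit.
Unset Printing Implicit Defensive.

(** * Computable polynomials and Hecke algebra elements *)

Fixpoint zip_add (A : Type) (add : A -> A -> A) (s r : seq A) : seq A :=
  match s, r with
  | [::], _ => r
  | _, [::] => s
  | x :: s', y :: r' => add x y :: zip_add add s' r'
  end.

(** Keeping [[::]] fixed lets every scalar operation preserve the empty list, which is the value
    read for a missing coordinate. *)
Definition shift_coef (A : Type) (x0 : A) (s : seq A) : seq A :=
  if s is [::] then [::] else x0 :: s.

(* Polynomials in z and t ^+ 2: the inner lists hold the coefficients of the
   powers of z, the outer list is indexed by the powers of t ^+ 2. *)
Definition coef := seq (seq Z).

Definition cadd : coef -> coef -> coef := zip_add (zip_add Z.add).
Definition copp : coef -> coef := map (map Z.opp).
Definition cmulz : coef -> coef := map (shift_coef Z0).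
Definition cmulT : coef -> coef := shift_coef [::].
Definition signed (e : bool) (c : coef) : coef := if e then c else copp c.

(* The Hecke algebra H_n: an element x of H_(m.+1) is the list of its
   coordinates x_a in H_m with respect to x = \sum_(a <= m) x_a D_a, where D_a
   is the product of a crossings [descend (sgn m) (m - a) a]. *)
Fixpoint hecke (n : nat) : Type := if n is m.+1 then seq (hecke m) else coef.

(** Lists may be shorter than their nominal length; a missing coordinate is zero. *)
Definition hzero (n : nat) : hecke n :=
  match n return hecke n with 0 => [::] | _.+1 => [::] end.

Fixpoint hadd (n : nat) : hecke n -> hecke n -> hecke n :=
  match n return hecke n -> hecke n -> hecke n with
  | 0 => cadd
  | m.+1 => zip_add (@hadd m)
  end.

Fixpoint hmap (f : coef -> coef) (n : nat) : hecke n -> hecke n :=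
  match n return hecke n -> hecke n with
  | 0 => f
  | m.+1 => map (@hmap f m)
  end.

Fixpoint split_at (A : Type) (x0 : A) (f h : A -> A) (mix : A -> A -> A * A)
    (d : nat) (s : seq A) {struct s} : seq A :=
  match s, d with
  | [::], _ => [::]
  | x :: s', d'.+1 => f x :: split_at x0 f h mix d' s'
  | x :: s', 0 =>
      let y := mix x (head x0 s') in y.1 :: y.2 :: map h (behead s')
  end.

Fixpoint descend (e : bool) (l a : nat) : diagram :=
  if a is b.+1 then Cross (l + b) e :: descend e l b else [::].

Definition braid (n : nat) (w : diagram) : bool :=
  all (fun x => if x is Cross i _ then i.+1 < n else false) w.

Section Evaluation.

Variable sgn : nat -> bool.

Definition block (m a : nat) : diagram := descend (sgn m) (m - a) a.

(* The coordinates of (x D_d + y D_(d.+1)) sigma^o, where sigma^e is the last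
   crossing of D_(d.+1). *)
Definition mix (m : nat) (e o : bool) (x y : hecke m) : hecke m * hecke m :=
  if o == e then (y, hadd x (hmap (fun c => signed e (cmulz c)) y))
  else (hadd y (hmap (fun c => signed (~~ e) (cmulz c)) x), x).

(** Put [d = m - i.+1], so that [D_(d.+1)] is [D_d] followed by a crossing at [i]. For [a < d] the
    new crossing commutes with [D_a]; at [d] and [d.+1] the quadratic relation mixes two
    coordinates; for larger [a] it passes through [D_a] and comes out at position [i.-1]. *)
Fixpoint hmul (n i : nat) (o : bool) : hecke n -> hecke n :=
  match n return hecke n -> hecke n with
  | 0 => id
  | m.+1 => split_at (hzero m) (@hmul m i o) (@hmul m i.-1 o)
              (mix (sgn m) o) (m - i.+1)
  end.

Fixpoint hmulw (n : nat) (x : hecke n) (w : diagram) : hecke n :=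
  if w is y :: w' then
    hmulw (if y is Cross i o then hmul i o x else x) w'
  else x.

(* Closing the last strand, up to the factor t * z that makes it polynomial. *)
Definition hclose (m : nat) (x : hecke m.+1) : hecke m :=
  hadd (hmap (fun c => cadd (cmulT c) (copp c)) (nth (hzero m) x 0))
    (hmap (fun c => cmulz (if sgn m then cmulT c else c))
      (foldr (@hadd m) (hzero m)
        [seq hmulw (nth (hzero m) x a.+1) (descend (sgn m) (m - a.+1) a)
           | a <- iota 0 m])).

(** A cup is the inclusion of H_n in H_(n+1), since [[:: x]] stands for [x D_0] and [D_0] is empty.
    A cap on no strand, or strands left at the end, give the default [[::]]. *)
Fixpoint evaluate (n : nat) (x : hecke n) (w : diagram) : coef :=
  match w with
  | [::] => match n return hecke n -> coef with 0 => id | _ => fun=> [::] end x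
  | Cup _ _ :: w' => @evaluate n.+1 [:: x] w'
  | Cross i o :: w' => @evaluate n (hmul i o x) w'
  | Cap _ :: w' =>
      match n return hecke n -> coef with
      | 0 => fun=> [::]
      | m.+1 => fun x => evaluate (hclose x) w'
      end x
  end.

End Evaluation.

(* Between two slices, the diagram has n upward strands on the left, on which
   all crossings take place, followed by the n downward strands closing them. *)
Fixpoint admissible (n : nat) (w : diagram) : bool :=
  match w with
  | [::] => n == 0
  | Cup i c :: w' => [&& i == n, c & admissible n.+1 w']
  | Cross i _ :: w' => (i.+1 < n) && admissible n w'
  | Cap i :: w' => (n == i.+1) && admissible i w'
  end.

Definition is_cap (x : slice) : bool := if x is Cap _ then true else false.

(** * Coordinates of sums and products; words in the generators *)

Lemma nth_zip_add (A : Type) (x0 : A) (add : A -> A -> A) (s r : seq A) a :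
    left_id x0 add -> right_id x0 add ->
  nth x0 (zip_add add s r) a = add (nth x0 s a) (nth x0 r a).
Proof.
move=> add0 addr0.
elim: s r a => [|x s IHs] [|y r] [|a] //=;
  by rewrite ?nth_nil ?add0 ?addr0 ?IHs.
Qed.

Lemma nth_map_zero (A B : Type) (x0 : A) (y0 : B) (f : A -> B) s a :
  f x0 = y0 -> nth y0 (map f s) a = f (nth x0 s a).
Proof. by move=> fx0; elim: s a => [|x s IHs] [|a] //=. Qed.

Lemma nth_split_at (A : Type) (x0 : A) (f h : A -> A) (mix : A -> A -> A * A)
    d s a :
    f x0 = x0 -> h x0 = x0 -> mix x0 x0 = (x0, x0) ->
  nth x0 (split_at x0 f h mix d s) a =
    if a < d then f (nth x0 s a) else
    if a == d then (mix (nth x0 s d) (nth x0 s d.+1)).1 else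
    if a == d.+1 then (mix (nth x0 s d) (nth x0 s d.+1)).2 else h (nth x0 s a).
Proof.
move=> f0 h0 mix0; elim: s d a => [|x s IHs] d a /=.
  by rewrite !nth_nil mix0 f0 h0 !if_same.
case: d => [|d].
  case: a => [|[|a]] //=; case: s {IHs} => [|y s] //=; rewrite ?nth_nil ?h0 //.
  by rewrite (nth_map_zero (x0 := x0)).
by case: a => [|a] //=; rewrite IHs ltnS !eqSS.
Qed.

Lemma hadd0x n : left_id (hzero n) (@hadd n).
Proof. by case: n. Qed.

Lemma haddx0 n : right_id (hzero n) (@hadd n).
Proof. by case: n => [|n] []. Qed.

Lemma hmap0 (f : coef -> coef) n : f [::] = [::] -> hmap f (hzero n) = hzero n.
Proof. by case: n. Qed.

Lemma hmul0 (sgn : nat -> bool) n i o : hmul sgn i o (hzero n) = hzero n.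
Proof. by case: n => //= m; case: (m - _). Qed.

Lemma mix0 m e o : mix e o (hzero m) (hzero m) = (hzero m, hzero m).
Proof. by rewrite /mix; case: ifP => _; rewrite hmap0 ?hadd0x //; case: e. Qed.

Lemma descend_rcons e l a :
  descend e l a.+1 = descend e l.+1 a ++ [:: Cross l e].
Proof.
elim: a => [|a IHa]; first by rewrite /= addn0.
rewrite -[descend e l a.+2]/(Cross (l + a.+1) e :: descend e l a.+1) IHa.
by rewrite addnS -addSn.
Qed.

Lemma braid_cat n u v : braid n (u ++ v) = braid n u && braid n v.
Proof. exact: all_cat. Qed.

Lemma braid_descend n e l a : l + a < n -> braid n (descend e l a).
Proof.
elim: a => //= a IHa; rewrite addnS => ltn; rewrite ltn IHa //.
exact: ltn_trans ltn.
Qed.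

Lemma braid_block n (sgn : nat -> bool) m a :
  a <= m -> m < n -> braid n (block sgn m a).
Proof. by move=> leam ltmn; apply: braid_descend; rewrite subnK. Qed.

Lemma braid_widen m n w : m <= n -> braid m w -> braid n w.
Proof.
move=> lemn; apply: sub_all => -[//|//|i _] lti; exact: leq_trans lemn.
Qed.

Local Open Scope ring_scope.

(** * Evaluating coefficient lists in a ring *)

Section Horner.

Variable R : comPzRingType.

Definition horner_with (A : Type) (f : A -> R) (x : R) (s : seq A) : R :=
  foldr (fun a r => f a + x * r) 0 s.

Lemma horner_with_add (A : Type) (add : A -> A -> A) (f : A -> R) x s r :
    (forall a b, f (add a b) = f a + f b) ->
  horner_with f x (zip_add add s r) = horner_with f x s + horner_with f x r.
Proof.
move=> fD; elim: s r => [|a s IHs] [|b r] /=; rewrite ?add0r ?addr0 //.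
by rewrite IHs fD; ring.
Qed.

Lemma horner_with_scale (A : Type) (h : A -> A) (f : A -> R) c x s :
    (forall a, f (h a) = c * f a) ->
  horner_with f x (map h s) = c * horner_with f x s.
Proof.
by move=> fh; elim: s => [|a s /= ->] /=; rewrite ?mulr0 // fh; ring.
Qed.

Lemma horner_with_shift (A : Type) (a0 : A) (f : A -> R) x s :
  f a0 = 0 -> horner_with f x (shift_coef a0 s) = x * horner_with f x s.
Proof. by case: s => [|a s] f0 /=; rewrite ?mulr0 // f0 add0r. Qed.

Variables z t : R.

Definition zval (s : seq Z) : R := horner_with (fun a => (int_of_Z a)%:~R) z s.

Definition cval (c : coef) : R := horner_with zval (t ^+ 2) c.

Lemma cval_add c d : cval (cadd c d) = cval c + cval d.
Proof.
apply: horner_with_add => a b; apply: horner_with_add => m n.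
by rewrite (raddfD int_of_Z) rmorphD.
Qed.

Lemma cval_opp c : cval (copp c) = - cval c.
Proof.
rewrite -mulN1r; apply: horner_with_scale => a; apply: horner_with_scale => m.
by rewrite (raddfN int_of_Z) rmorphN mulN1r.
Qed.

Lemma cval_mulz c : cval (cmulz c) = z * cval c.
Proof. by apply: horner_with_scale => a; apply: horner_with_shift. Qed.

Lemma cval_mulT c : cval (cmulT c) = t ^+ 2 * cval c.
Proof. exact: horner_with_shift. Qed.

Lemma cval_signed e c : cval (signed e c) = (if e then 1 else -1) * cval c.
Proof. by case: e; rewrite /= ?cval_opp ?mul1r ?mulN1r. Qed.

End Horner.

(** * Linear functionals on the Hecke algebra *)

Section HeckeFunctionals.

Variable R : comPzRingType.
Variables z t : R.

(* g factors through a linear functional on the Hecke algebra H_n. *)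
Record hecke_functional (n : nat) (g : diagram -> R) : Prop := {
  hecke_far : forall u v i j o o', (i.+1 < j)%N -> (j.+1 < n)%N ->
    braid n u -> braid n v ->
    g (u ++ Cross i o :: Cross j o' :: v) =
    g (u ++ Cross j o' :: Cross i o :: v);
  hecke_braid : forall u v i e o, (i.+2 < n)%N -> braid n u -> braid n v ->
    g (u ++ Cross i.+1 e :: Cross i e :: Cross i.+1 o :: v) =
    g (u ++ Cross i o :: Cross i.+1 e :: Cross i e :: v);
  hecke_cancel : forall u v i o, (i.+1 < n)%N -> braid n u -> braid n v ->
    g (u ++ Cross i o :: Cross i (~~ o) :: v) = g (u ++ v);
  hecke_skein : forall u v i, (i.+1 < n)%N -> braid n u -> braid n v ->
    g (u ++ Cross i true :: v) - g (u ++ Cross i false :: v) = z * g (u ++ v)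
}.

(** Right multiplication by [w] followed by restriction to H_m. With [w = block sgn m a] it gives
    the functional acting on the coordinate [x_a], so inductions on the number of strands go
    through. *)
Lemma hecke_functional_cat m n g w : (m <= n)%N -> braid n w ->
  hecke_functional n g -> hecke_functional m (fun u => g (u ++ w)).
Proof.
move=> lemn bw [far brd can ske].
have wd u : braid m u -> braid n u by exact: braid_widen.
have wdw v : braid m v -> braid n (v ++ w) by move=> bv; rewrite braid_cat wd.
split=> [u v i j o o' ij jm bu bv|u v i e o im bu bv|u v i o im bu bv
        |u v i im bu bv]; rewrite -!catA /=.
- by apply: far => //; [exact: leq_trans lemn|exact: wd|exact: wdw].
- by apply: brd; [exact: leq_trans lemn|exact: wd|exact: wdw].
- by apply: can; [exact: leq_trans lemn|exact: wd|exact: wdw].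
- by apply: ske; [exact: leq_trans lemn|exact: wd|exact: wdw].
Qed.

Section Slide.

Variables (n : nat) (g : diagram -> R).
Hypothesis hg : hecke_functional n g.

Lemma slide_below u v i o e l a : (i.+1 < l)%N -> (l + a < n)%N ->
    braid n u -> braid n v ->
  g (u ++ descend e l a ++ Cross i o :: v) =
  g (u ++ Cross i o :: descend e l a ++ v).
Proof.
move=> il + + bv; elim: a u => [|a IHa] u //= lan bu.
have ln : (l + a < n)%N by apply: leq_ltn_trans lan; rewrite leq_add2l.
rewrite -cat_rcons IHa ?cat_rcons //; last first.
  by rewrite -cats1 braid_cat bu /= -addnS lan.
apply/esym/(hecke_far hg) => //; first exact: ltn_addr.
  by rewrite -addnS.
by rewrite braid_cat braid_descend.
Qed.

Lemma slide_above u v i o e l a : (l + a < i)%N -> (i.+1 < n)%N ->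
    braid n u -> braid n v ->
  g (u ++ Cross i o :: descend e l a ++ v) =
  g (u ++ descend e l a ++ Cross i o :: v).
Proof.
move=> + lin + bv; elim: a u => [|a IHa] u //=.
rewrite addnS => lai bu; have lan := ltn_trans lai (ltnW lin).
rewrite -(hecke_far hg) //; last first.
  by rewrite braid_cat bv braid_descend // ltnW.
rewrite -[LHS]/
  (g (u ++ [:: Cross (l + a) e] ++ Cross i o :: descend e l a ++ v)).
rewrite catA IHa -?catA //; first exact: ltnW.
by rewrite braid_cat bu /= lan.
Qed.

(** The crossing at [i.+1] commutes backwards with the crossings of index below [i], meets the
    consecutive pair [i.+1], [i], crosses it by the braid relation and becomes a crossing at [i],
    which commutes with the remaining ones of index above [i.+1]. *)
Lemma slide_through u v i o e l a : (l <= i)%N -> (i.+1 < l + a)%N ->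
    (l + a < n)%N -> braid n u -> braid n v ->
  g (u ++ descend e l a ++ Cross i.+1 o :: v) =
  g (u ++ Cross i o :: descend e l a ++ v).
Proof.
move=> li + + + bv; elim: a u => [|a IHa] u.
  by rewrite addn0 ltnNge (leq_trans li).
rewrite addnS /= ltnS leq_eqVlt => /orP[/eqP ila|ila] lan bu; last first.
  have bu' : braid n (rcons u (Cross (l + a) e)).
    by rewrite -cats1 braid_cat bu /= lan.
  rewrite -cat_rcons (IHa _ ila (ltnW lan) bu') cat_rcons.
  apply/esym/(hecke_far hg) => //.
  by rewrite braid_cat bv braid_descend // ltnW.
case: a ila lan {IHa} => [|a]; rewrite ?addn0 => ila lan.
  by rewrite -ila ltnn in li.
move: ila; rewrite addnS => -[->] /=.
rewrite addnS in lan.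
have bu' : braid n (rcons (rcons u (Cross (l + a).+1 e)) (Cross (l + a) e)).
  by rewrite -!cats1 !braid_cat bu /= lan ltnW.
have := slide_above o e (ltnSn _) lan bu' bv; rewrite !cat_rcons => <-.
apply: (hecke_braid hg) => //.
by rewrite braid_cat bv braid_descend // ltnW // ltnW.
Qed.

End Slide.

(** * Functionals evaluated on normal forms *)

Variable sgn : nat -> bool.

(** The linear extension of [g] from normal form words to their combinations. It makes sense for any
    [g]; the Hecke relations are only needed to compare words not in normal form. Entries of [x]
    beyond index [m] do not contribute. *)
Fixpoint value (n : nat) : hecke n -> (diagram -> R) -> R :=
  match n return hecke n -> (diagram -> R) -> R with
  | 0 => fun c g => cval z t c * g [::]
  | m.+1 => fun x g => \sum_(0 <= a < m.+1)
      value (nth (hzero m) x a) (fun w => g (w ++ block sgn m a))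
  end.

Lemma eq_value n (x : hecke n) g g' :
  (forall w, braid n w -> g w = g' w) -> value x g = value x g'.
Proof.
elim: n x g g' => [|n IHn] x g g' eqg /=; first by rewrite eqg.
apply: eq_big_nat => a /andP[_ lea]; apply: IHn => w bw; apply: eqg.
by rewrite braid_cat (braid_widen _ bw) //= braid_block.
Qed.

Lemma value0 n g : value (hzero n) g = 0.
Proof.
elim: n g => [|n IHn] g /=; first by rewrite mul0r.
by rewrite big1 // => a _; rewrite nth_nil IHn.
Qed.

Lemma value_hadd n (x y : hecke n) g :
  value (hadd x y) g = value x g + value y g.
Proof.
elim: n x y g => [|n IHn] x y g /=; first by rewrite cval_add mulrDl.
rewrite -big_split; apply: eq_bigr => a _.
by rewrite nth_zip_add ?IHn //; [apply: hadd0x | apply: haddx0].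
Qed.

Lemma value_hmap f s n (x : hecke n) g : f [::] = [::] ->
    (forall c, cval z t (f c) = s * cval z t c) ->
  value (hmap f x) g = s * value x g.
Proof.
move=> f0 fs; elim: n x g => [|n IHn] x g /=; first by rewrite fs mulrA.
rewrite mulr_sumr; apply: eq_bigr => a _.
by rewrite (nth_map_zero (x0 := hzero n)) ?IHn // hmap0.
Qed.

Lemma value_lin n (x : hecke n) s g g' :
  value x (fun w => g w + s * g' w) = value x g + s * value x g'.
Proof.
elim: n x g g' => [|n IHn] x g g' /=; first by ring.
rewrite mulr_sumr -big_split; apply: eq_bigr => a _; exact: IHn.
Qed.

Definition zsign (e : bool) : R := if e then z else - z.

Lemma value_signed_z e n (x : hecke n) g :
  value (hmap (fun c => signed e (cmulz c)) x) g = zsign e * value x g.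
Proof.
apply: value_hmap => [|c]; first by case: e.
by rewrite cval_signed cval_mulz /zsign; case: e; ring.
Qed.

Lemma hecke_square n g u v i e : hecke_functional n g -> (i.+1 < n)%N ->
    braid n u -> braid n v ->
  g (u ++ Cross i e :: Cross i e :: v) =
  g (u ++ v) + zsign e * g (u ++ Cross i e :: v).
Proof.
move=> hg lin bu bv.
have bu' : braid n (rcons u (Cross i e)).
  by rewrite -cats1 braid_cat bu /= lin.
have := hecke_skein hg lin bu' bv; rewrite !cat_rcons.
have := hecke_cancel hg e lin bu bv.
case: (e) => /= -> /eqP; rewrite subr_eq => /eqP.
  by rewrite addrC.
by move=> ->; rewrite mulNr [in RHS]addrC addKr.
Qed.

Lemma hecke_inverse n g u v i e : hecke_functional n g -> (i.+1 < n)%N ->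
    braid n u -> braid n v ->
  g (u ++ Cross i (~~ e) :: v) =
  g (u ++ Cross i e :: v) + zsign (~~ e) * g (u ++ v).
Proof.
move=> hg lin bu bv; have := hecke_skein hg lin bu bv.
by case: e => /=; rewrite ?mulNr => <-; ring.
Qed.

Lemma value_hmul n (x : hecke n) i o g : hecke_functional n g -> (i.+1 < n)%N ->
  value (hmul sgn i o x) g = value x (fun w => g (w ++ [:: Cross i o])).
Proof.
elim: n x i g => // m IHm x i g hg lin /=.
set d := (m - i.+1)%N.
have im : (i.+1 <= m)%N by [].
have md : (d.+1 + i = m)%N by rewrite /d addSnnS subnK.
have hgB a : (a < m.+1)%N ->
    hecke_functional m (fun w => g (w ++ block sgn m a)).
  by move=> am; apply: (hecke_functional_cat _ _ hg); rewrite ?braid_block.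
have dm : (d.+1 < m.+1)%N by rewrite ltnS -md leq_addr.
pose y a := nth (hzero m) x a.
under eq_bigr do rewrite nth_split_at ?hmul0 ?mix0 //.
rewrite -/(y d) -/(y d.+1).
have split3 (F : nat -> R) : \sum_(0 <= a < m.+1) F a =
    \sum_(0 <= a < d) F a + (F d + F d.+1) + \sum_(d.+2 <= a < m.+1) F a.
  rewrite (big_cat_nat (n := d)) //=; last exact: ltnW (ltnW dm).
  rewrite (@big_ltn _ _ _ d) ?(ltnW dm) // (@big_ltn _ _ _ d.+1) //.
  by rewrite !addrA.
rewrite !split3; congr (_ + _ + _).
(* All crossings of [D_a] lie above position [i.+1], so the new one commutes with them. *)
- apply: eq_big_nat => a /= ad; rewrite ad.
  have am : (a < m.+1)%N by apply: ltn_trans ad (ltnW dm).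
  have iam : (i.+1 < m - a)%N.
    by rewrite ltn_subRL -[ltnRHS]md addnS addSn ltnS ltn_add2r.
  rewrite (IHm _ _ _ (hgB a am) (leq_trans iam (leq_subr _ _))).
  apply: eq_value => w bw; rewrite -!catA.
  rewrite (slide_below hg (v := [::])) ?cats0 ?subnK //.
  exact: braid_widen bw.
- rewrite /= ltnn eqxx ltnNge leqnSn /= (gtn_eqF (ltnSn d)) eqxx.
  set e := sgn m.
  have Bd : block sgn m d.+1 = block sgn m d ++ [:: Cross i e].
    have mdi : (m - d.+1 = i)%N by rewrite -[X in (X - _)%N]md addKn.
    have mdi1 : (m - d = i.+1)%N by rewrite -[X in (X - _)%N]md addSnnS addKn.
    by rewrite /block mdi mdi1 descend_rcons.
  have bB w : braid m w -> braid m.+1 (w ++ block sgn m d).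
    by move=> bw; rewrite braid_cat (braid_widen _ bw) // braid_block // ltnW.
  (* If [o = e], the square of the last crossing of [D_(d.+1)] is reduced by the quadratic relation;
     otherwise that crossing cancels, and on [D_d] the inverse crossing is rewritten by the skein
     relation. *)
  rewrite /mix; case: eqP => [-> | /eqP neo].
    rewrite value_hadd value_signed_z.
    under [in RHS]eq_value do rewrite -catA -Bd.
    rewrite addrC -addrA; congr (_ + _).
    rewrite addrC -value_lin; apply: eq_value => w bw.
    rewrite Bd -!catA /=.
    have := hecke_square e hg im (bB w bw) (isT : braid m.+1 [::]).
    by rewrite cats0 -!catA /= => ->.
  have -> : o = ~~ e by case: (o) (e) neo => -[].
  rewrite value_hadd value_signed_z.
  rewrite [in RHS]addrC -addrA; congr (_ + _).
    apply: eq_value => w bw; rewrite Bd -!catA /=.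
    have := hecke_cancel hg e im (bB w bw) (isT : braid m.+1 [::]).
    by rewrite cats0 -!catA /= => ->.
  rewrite addrC -value_lin; apply: eq_value => w bw.
  rewrite Bd -!catA /=.
  have := hecke_inverse e hg im (bB w bw) (isT : braid m.+1 [::]).
  by rewrite cats0 -!catA /= => ->.
- apply: eq_big_nat => a /andP[da am].
  rewrite ltnNge (ltnW (ltnW da)) /= (gtn_eqF (ltnW da)) (gtn_eqF da).
  have mai : (m - a < i)%N.
    by rewrite ltn_subLR // -[ltnLHS]md ltn_add2r.
  (* Here [m - a < i], hence [i] is positive and [i.-1] is not truncated. *)
  case: i lin @d im md da mai {dm y split3} => // i lin d im md da mai.
  rewrite /= (IHm _ _ _ (hgB a am)) //.
  apply: eq_value => w bw; rewrite -!catA.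
  rewrite (slide_through hg (v := [::])) ?cats0 ?subnK //.
  exact: braid_widen bw.
Qed.

Lemma value_hmulw n (x : hecke n) w g : hecke_functional n g -> braid n w ->
  value (hmulw sgn x w) g = value x (fun u => g (u ++ w)).
Proof.
move=> hg; elim: w x => [|[//|//|i o] w IHw] x /=.
  by move=> _; apply: eq_value => u _; rewrite cats0.
case/andP=> lin bw; rewrite IHw // value_hmul //.
  by apply: eq_value => u _; rewrite -catA.
exact: hecke_functional_cat hg.
Qed.

Lemma value_hclose m (x : hecke m.+1) g g' :
    hecke_functional m g' ->
    (forall w, braid m w -> t * z * g w = (t ^+ 2 - 1) * g' w) ->
    (forall w w' o, (0 < m)%N -> braid m w -> braid m w' ->
      t * z * g (w ++ Cross m.-1 o :: w') =
      z * (if o then t ^+ 2 else 1) * g' (w ++ w')) ->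
  value (hclose sgn x) g' = t * z * value x g.
Proof.
move=> hg' circle kink.
have lin s (y : hecke m) h h' :
    (forall w, braid m w -> t * z * h w = s * h' w) ->
    t * z * value y h = s * value y h'.
  (* Homogeneity is extracted from [value_lin] with a zero first function; the value of the zero
     function vanishes by taking the scalar to be -1. *)
  move=> hh'; have scale r k : value y (fun w => r * k w) = r * value y k.
    have := value_lin y r (fun=> 0) k.
    under eq_value do rewrite add0r.
    move=> ->; have := value_lin y (-1) (fun=> 0) (fun=> 0).
    under eq_value do rewrite mulr0 add0r.
    by rewrite mulN1r subrr => ->; rewrite add0r.
  by rewrite -!scale; apply: eq_value.
rewrite /= big_nat_recl // mulrDr value_hadd; congr (_ + _).
  rewrite (@value_hmap _ (t ^+ 2 - 1)) // => [|c]; last first.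
    by rewrite cval_add cval_opp cval_mulT; ring.
  apply/esym/lin => w bw; rewrite -circle // /block subn0.
  by rewrite cats0.
rewrite (@value_hmap _ (z * (if sgn m then t ^+ 2 else 1))); first last.
- by move=> c; rewrite cval_mulz; case: ifP => _; rewrite ?cval_mulT; ring.
- by case: ifP.
have value_foldr (ys : seq (hecke m)) h :
    value (foldr (@hadd m) (hzero m) ys) h = \sum_(y <- ys) value y h.
  elim: ys => [|y ys IHys] /=; first by rewrite big_nil value0.
  by rewrite value_hadd IHys big_cons.
rewrite value_foldr big_map -[in iota 0 m](subn0 m).
rewrite !mulr_sumr; apply: eq_big_nat => a /= am.
have bD : braid m (descend (sgn m) (m - a.+1) a).
  by apply: braid_descend; rewrite -addnS subnK.
rewrite value_hmulw //; apply/esym/lin => w bw.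
have m0 : (0 < m)%N by apply: leq_ltn_trans am.
rewrite -kink //; congr (_ * g (w ++ Cross _ _ :: _)).
by rewrite -[in RHS](subnK am) addnS.
Qed.

End HeckeFunctionals.

(** * Nonvanishing of the denominators *)

Lemma exp_sub_inv_neq0 (F : fieldType) (x : F) d :
  x != 0 -> x ^+ (d + d) != 1 -> x ^+ d - x ^- d != 0.
Proof.
move=> x0; apply: contraNneq => /subr0_eq E.
by rewrite exprD {2}E mulfV ?expf_neq0.
Qed.

Lemma q_neq0 : q != 0.
Proof. by rewrite tofrac_eq0 polyC_eq0 polyX_eq0. Qed.

Lemma br_neq0 d : (0 < d)%N -> br d != 0.
Proof.
move=> d0; apply: exp_sub_inv_neq0; first exact: q_neq0.
rewrite -tofracXn -tofrac1 tofrac_eq -rmorphXn /= -polyC1.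
rewrite (inj_eq (@polyC_inj _)); apply/eqP => /(congr1 (size \o val)) /=.
by rewrite size_polyXn size_poly1 => -[]; case: d d0.
Qed.

Lemma t_neq0 : t != 0.
Proof. by rewrite tofrac_eq0 polyX_eq0. Qed.

Lemma br1 : br 1 = z.
Proof. by rewrite /br expr1. Qed.

Lemma z_neq0 : z != 0.
Proof. by rewrite -br1 br_neq0. Qed.

(** * Diagrams between n upward strands and their closing strands *)

Lemma valid_cat s u v : valid s (u ++ v) = valid s u && valid (level s u) v.
Proof. by elim: u s => //= x u IHu s; rewrite IHu andbA. Qed.

Lemma is_tangle_cat s u v s' :
  is_tangle s (u ++ v) s' = valid s u && is_tangle (level s u) v s'.
Proof. by rewrite /is_tangle valid_cat /level foldl_cat andbA. Qed.

Definition opening (n : nat) : diagram := cups 0 (nseq n true).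
Definition strands (n : nat) : seq bool := nseq n true ++ nseq n false.

Lemma openingS n : opening n.+1 = opening n ++ [:: Cup n true].
Proof.
have cupsE i : cups i (nseq n.+1 true) =
    cups i (nseq n true) ++ [:: Cup (i + n) true].
  elim: n i => [|n IHn] i; first by rewrite addn0.
  by rewrite -[LHS]/(Cup i true :: cups i.+1 (nseq n.+1 true)) IHn addSnnS.
by rewrite /opening cupsE.
Qed.

Lemma is_tangle_cup n w s :
  is_tangle (strands n) (Cup n true :: w) s = is_tangle (strands n.+1) w s.
Proof.
rewrite /is_tangle /= size_cat size_nseq leq_addr /=.
rewrite /step /= take_size_cat ?size_nseq // drop_size_cat ?size_nseq //.
suff -> : nseq n true ++ [:: true, false & nseq n false] = strands n.+1 by [].
rewrite /strands -cat_rcons; congr (_ ++ _).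
by elim: n => //= n ->.
Qed.

Lemma is_tangle_cap n w s :
  is_tangle (strands n.+1) (Cap n :: w) s = is_tangle (strands n) w s.
Proof.
have -> : strands n.+1 = nseq n true ++ [:: true, false & nseq n false].
  rewrite /strands -[RHS]cat_rcons; congr (_ ++ _).
  by elim: n => //= n ->.
rewrite /is_tangle /= size_cat /= !size_nseq !addnS !ltnS leq_addr /=.
rewrite !nth_cat size_nseq ltnn subnn ltnNge leqnSn subSnn /=.
rewrite /step /= take_size_cat ?size_nseq //.
by rewrite drop_cat size_nseq ltnNge ltnW // -addn2 addKn /= drop0.
Qed.

Lemma is_tangle_cross n i o w s : (i.+1 < n)%N ->
  is_tangle (strands n) (Cross i o :: w) s = is_tangle (strands n) w s.
Proof.
move=> lin; rewrite -cat1s is_tangle_cat.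
have -> : valid (strands n) [:: Cross i o].
  by rewrite /= size_cat !size_nseq ltn_addr.
suff -> : level (strands n) [:: Cross i o] = strands n by [].
have -> : strands n =
    nseq i true ++ [:: true, true & nseq (n - i.+2) true ++ nseq n false].
  by rewrite /strands -{1}(subnKC lin) !addSnnS nseqD -catA.
rewrite /level /= /step /= take_size_cat ?size_nseq //.
rewrite drop_size_cat ?size_nseq //.
have di : (i.+2 - i = 2)%N by rewrite -addn2 addKn.
by rewrite drop_cat size_nseq ltnNge ltnW // di /= !drop0 take0.
Qed.

Lemma is_tangle_braid n u v s :
  braid n u -> is_tangle (strands n) (u ++ v) s = is_tangle (strands n) v s.
Proof.
elim: u => [|[//|//|i o] u IHu] //= /andP[lin bu].
by rewrite is_tangle_cross ?IHu.
Qed.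

Lemma opening_strands n :
  valid [::] (opening n) /\ level [::] (opening n) = strands n.
Proof.
elim: n => [//|n [valn lev]].
have /andP[fit /eqP stepn] :
    is_tangle (strands n) [:: Cup n true] (strands n.+1).
  by rewrite is_tangle_cup /is_tangle /= eqxx.
rewrite openingS valid_cat valn lev fit /level foldl_cat.
by rewrite -!/(level _ _) lev stepn.
Qed.

Lemma is_link_opening n w :
  is_link (opening n ++ w) = is_tangle (strands n) w [::].
Proof.
have [valn lev] := opening_strands n.
by rewrite /is_link is_tangle_cat valn lev.
Qed.

Lemma admissible_tangle n w :
  admissible n w -> is_tangle (strands n) w [::].
Proof.
elim: w n => [|[i c|i|i o] w IHw] n /=.
- by move=> /eqP->.
- by case/and3P=> /eqP-> -> /IHw; rewrite is_tangle_cup.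
- by case/andP=> /eqP-> /IHw; rewrite is_tangle_cap.
- by case/andP=> lin /IHw; rewrite is_tangle_cross.
Qed.

(** * From the skein relations to evaluation in the Hecke algebra *)

Section Homfly.

Variable H : diagram -> K.
Hypothesis hH : framed_homfly H.

Lemma homfly_move u v l r : move l r ->
    is_link (u ++ l ++ v) -> is_link (u ++ r ++ v) ->
  H (u ++ l ++ v) = H (u ++ r ++ v).
Proof. by move=> lr Ll Lr; apply/(homfly_isotopic hH)/isotopic_move. Qed.

Lemma homfly_exchange u v i o x : (i.+1 < pos x)%N ->
    is_link (u ++ Cross i o :: x :: v) -> is_link (u ++ x :: Cross i o :: v) ->
  H (u ++ Cross i o :: x :: v) = H (u ++ x :: Cross i o :: v).
Proof.
(* [Exchange] takes the right slice before its shift; a crossing has two legs on each side, so the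
   shift is 2 both times. *)
move=> ix; pose y := match x with
  | Cup k c => Cup (k - 2) c | Cap k => Cap (k - 2)
  | Cross k c => Cross (k - 2) c end.
have yx : shift 2 y = x.
  by rewrite /y; case: x ix {y} => [k c|k|k c] /= ik;
    rewrite subnKC // (leq_trans _ ik).
have iy : (pos (Cross i o) <= pos y)%N.
  by rewrite -(leq_add2l 2) /=; case: (y) yx => [k c|k|k c] /= <- in ix *.
by have := @homfly_move u v _ _ (Exchange iy); rewrite /= yx.
Qed.

(** All crossings of [w] lie to the left of [x], so they move past it one at a time. The hypothesis
    on splittings of [w] is there because isotopies may only pass through link diagrams. *)
Lemma homfly_slide u w x v : braid (pos x) w ->
    (forall w1 w2, w = w1 ++ w2 -> is_link (u ++ w1 ++ x :: w2 ++ v)) ->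
  H (u ++ w ++ x :: v) = H (u ++ x :: w ++ v).
Proof.
elim/last_ind: w v => [//|w [i c|i|i o] IHw] v;
  rewrite -cats1 braid_cat ?andbF //= andbT => /andP[bw ix] Lw.
rewrite -!catA cat1s catA homfly_exchange // -?catA ?IHw //=.
- move=> w1 w2 defw; have := Lw w1 (w2 ++ [:: Cross i o]).
  by rewrite defw -!catA => /(_ erefl).
- by have := Lw (w ++ [:: Cross i o]) [::]; rewrite cats0 -catA => /(_ erefl).
- by have := Lw w [:: Cross i o] erefl.
Qed.

(** With [v] fixed, a function of the braid [w]: this is the functional on H_n to which the algebra
    is applied. *)
Definition closed_by (n : nat) (v w : diagram) : K := H (opening n ++ w ++ v).

Lemma closed_by_hecke n v : is_tangle (strands n) v [::] ->
  hecke_functional z n (closed_by n v).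
Proof.
move=> tv; have L w : braid n w -> is_link ((opening n ++ w) ++ v).
  by move=> bw; rewrite -catA is_link_opening is_tangle_braid.
rewrite /closed_by; split=> [u w i j o o' ij jn bu bw|u w i e o lin bu bw
  |u w i o lin bu bw|u w i lin bu bw].
- rewrite -!catA /= !(catA (opening n) u); have jn' := ltnW jn.
  have lin : (i.+1 < n)%N by apply: ltn_trans ij jn'.
  apply: homfly_exchange => //.
  + by have := L (u ++ Cross i o :: Cross j o' :: w); rewrite braid_cat /=
      bu lin jn bw -!catA => /(_ isT).
  + by have := L (u ++ Cross j o' :: Cross i o :: w); rewrite braid_cat /=
      bu lin jn bw -!catA => /(_ isT).
- rewrite -!catA /= !(catA (opening n) u); have lin' := ltnW lin.
  (* Two adjacent crossings share the sign [e], so the over-strand relation is not cyclic and [R3]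
     applies. *)
  have mv : move [:: Cross i o; Cross i.+1 e; Cross i e]
                 [:: Cross i.+1 e; Cross i e; Cross i.+1 o].
    by apply: R3; case: eqP => [->|]; rewrite ?eqxx.
  apply/esym/(homfly_move mv) => /=.
  + by have := L (u ++ Cross i o :: Cross i.+1 e :: Cross i e :: w); rewrite
      braid_cat /= bu lin lin' bw -!catA => /(_ isT).
  + by have := L (u ++ Cross i.+1 e :: Cross i e :: Cross i.+1 o :: w); rewrite
      braid_cat /= bu lin lin' bw -!catA => /(_ isT).
- rewrite -!catA /= !(catA (opening n) u).
  apply: (homfly_move (R2 i o)) => /=.
  + by have := L (u ++ Cross i o :: Cross i (~~ o) :: w); rewrite
      braid_cat /= bu lin bw -!catA => /(_ isT).
  + by have := L (u ++ w); rewrite braid_cat bu bw -!catA => /(_ isT).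
- rewrite -!catA /= !(catA (opening n) u).
  have [_ lev] := opening_strands n.
  have nthT k : (k < n)%N -> nth false (strands n) k = true.
    by move=> kn; rewrite nth_cat size_nseq kn nth_nseq kn.
  have levu : level [::] (opening n ++ u) = strands n.
    rewrite /level foldl_cat -/(level [::] (opening n)) lev -/(level _ u).
    have := is_tangle_braid [::] (strands n) bu.
    by rewrite cats0 /is_tangle /= eqxx => /andP[_ /eqP].
  apply: (homfly_skein hH).
  have := @ConwayTriple (opening n ++ u) (w ++ v) i.
  rewrite levu !nthT ?(ltnW lin) //=; apply.
  by have := L (u ++ Cross i true :: w); rewrite
      braid_cat /= bu lin bw -!catA => /(_ isT).
Qed.

Lemma closed_by_cup n v w : braid n w -> is_tangle (strands n.+1) v [::] ->
  closed_by n (Cup n true :: v) w = closed_by n.+1 v w.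
Proof.
move=> bw tv; rewrite /closed_by openingS -catA homfly_slide // => w1 w2 defw.
move: bw; rewrite defw braid_cat => /andP[bw1 bw2].
by rewrite is_link_opening is_tangle_braid // is_tangle_cup is_tangle_braid //
  (braid_widen _ bw2).
Qed.

Lemma closed_by_cap n v w w' : braid n.+1 w -> braid n w' ->
    is_tangle (strands n) v [::] ->
  closed_by n.+1 (Cap n :: v) (w ++ w') = closed_by n.+1 (Cap n :: w' ++ v) w.
Proof.
move=> bw bw' tv; rewrite /closed_by -catA catA homfly_slide // -?catA //.
move=> w1 w2 defw; move: bw'; rewrite defw braid_cat => /andP[bw1 bw2].
by rewrite -catA is_link_opening !is_tangle_braid ?is_tangle_cap
  ?is_tangle_braid // (braid_widen _ bw1).
Qed.

Lemma closed_by_circle n v w : braid n w -> is_tangle (strands n) v [::] ->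
  t * z * closed_by n.+1 (Cap n :: v) w = (t ^+ 2 - 1) * closed_by n v w.
Proof.
move=> bw tv; rewrite -closed_by_cup ?is_tangle_cap // /closed_by.
rewrite (catA _ w) (homfly_circle hH (u := opening n ++ w)); last first.
  by rewrite -catA is_link_opening is_tangle_braid //= is_tangle_cup
    is_tangle_cap.
rewrite -catA -/z mulrA; congr (_ * _).
by rewrite mulrA (mulrAC t) mulfK ?z_neq0 // mulrBr mulfV ?t_neq0.
Qed.

(** Sliding [w] below the last cup and [w'] above the last cap makes cup, crossing and cap
    consecutive, and they form a right kink. *)
Lemma closed_by_kink n v w w' o : (0 < n)%N -> braid n w -> braid n w' ->
    is_tangle (strands n) v [::] ->
  t * z * closed_by n.+1 (Cap n :: v) (w ++ Cross n.-1 o :: w') =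
  z * (if o then t ^+ 2 else 1) * closed_by n v (w ++ w').
Proof.
case: n => // n _ bw bw' tv.
have tw : is_tangle (strands n.+1) (w' ++ v) [::] by rewrite is_tangle_braid.
rewrite -cat_rcons closed_by_cap //; last first.
  by rewrite -cats1 braid_cat (braid_widen _ bw) //= leqnn.
rewrite {1}/closed_by cat_rcons.
rewrite -/(closed_by n.+2 [:: Cross n o, Cap n.+1 & w' ++ v] w).
rewrite -closed_by_cup // ?is_tangle_cross ?is_tangle_cap // /closed_by catA.
rewrite (homfly_kink hH (u := opening n.+1 ++ w) (left := false)
  (i := n) (a := true) (o := o)); last first.
  by rewrite -catA is_link_opening is_tangle_braid //= is_tangle_cup
    is_tangle_cross // is_tangle_cap.
rewrite -!catA mulrA; congr (_ * _).
by case: (o); rewrite mulrAC ?divff ?t_neq0 // mulrC ?mulr1.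
Qed.

(** By induction on [v], its first slice is absorbed into the element [x]; each cap absorbed costs
    one factor [t * z]. *)
Lemma value_evaluate (sgn : nat -> bool) n (x : hecke n) v : admissible n v ->
  value z t sgn x (closed_by n v) * (t * z) ^+ count is_cap v =
  cval z t (evaluate sgn x v).
Proof.
elim: v n x => [|[i c|i|i o] v IHv] n x /=.
- by case: n x => // x _; rewrite /= /closed_by /= (homfly_empty hH) !mulr1.
- case/and3P=> /eqP-> -> adm; rewrite -IHv //; congr (_ * _) => /=.
  rewrite big_nat_recl // [X in _ = _ + X]big1 ?addr0 => [|a _]; last first.
    by rewrite /= nth_nil value0.
  apply: eq_value => w bw; rewrite /block subn0 /= cats0.
  by rewrite closed_by_cup ?admissible_tangle.
- case/andP=> /eqP; case: n x => // n x [<-] adm.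
  have tv := admissible_tangle adm.
  rewrite -IHv // exprS mulrA; congr (_ * _).
  rewrite (@value_hclose _ z t sgn n x (closed_by n.+1 (Cap n :: v))).
  + by rewrite mulrC.
  + exact: closed_by_hecke.
  + by move=> w bw; apply: closed_by_circle.
  + by move=> w w' o n0 bw bw'; apply: closed_by_kink.
- case/andP=> lin adm; rewrite -IHv // value_hmul //.
    congr (_ * _); apply: eq_value => w _.
    by rewrite /closed_by -catA.
  exact/closed_by_hecke/admissible_tangle.
Qed.

Lemma homfly_evaluate (sgn : nat -> bool) w : admissible 0 w ->
  H w * (t * z) ^+ count is_cap w =
  cval z t (@evaluate sgn 0 [:: [:: Zpos xH]] w).
Proof.
move=> adm; rewrite -value_evaluate //= /closed_by /opening /=.
by rewrite /cval /zval /= !mulr0 !addr0 mul1r.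
Qed.

End Homfly.

(** * Membership in the ring of polynomials in z^2 and t^{+-1} *)

Definition spread (A : Type) (a0 : A) (s : seq A) : seq A :=
  flatten [seq [:: a; a0] | a <- s].

Lemma horner_with_spread (R : comPzRingType) (A : Type) (a0 : A) (f : A -> R)
    x s :
  f a0 = 0 -> horner_with f x (spread a0 s) = horner_with f (x ^+ 2) s.
Proof.
by move=> f0; elim: s => //= a s ->; rewrite f0 add0r mulrA expr2.
Qed.

Lemma horner_with_sum (R : comPzRingType) (A : Type) (a0 : A) (f : A -> R)
    x s n :
    f a0 = 0 -> (size s <= n)%N ->
  horner_with f x s = \sum_(i < n) f (nth a0 s i) * x ^+ i.
Proof.
move=> f0; elim: s n => [|a s IHs] [|n] //= sn; rewrite ?big_ord0 //.
  by rewrite big1 // => i _; rewrite nth_nil f0 mul0r.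
rewrite big_ord_recl mulr1 (IHs n) // mulr_sumr; congr (_ + _).
by apply: eq_bigr => i _ /=; rewrite mulrCA -exprS.
Qed.

Lemma in_Zz2t_horner x d (c : seq (seq Z)) :
  x * t ^+ d = horner_with (zval (z ^+ 2)) t c -> in_Zz2t x.
Proof.
pose m := \max_(s <- c) size s.
move=> xt.
exists (fun i j => int_of_Z (nth Z0 (nth [::] c j) i)), m, (size c), d.
rewrite xt (@horner_with_sum _ _ [::] _ t c (size c)) // exchange_big /=.
apply: eq_bigr => j _; have sj : (size (nth [::] c j) <= m)%N.
  by rewrite /m (big_nth [::]) big_mkord (leq_bigmax j).
rewrite /zval (@horner_with_sum _ _ Z0 _ _ _ m) // mulr_suml.
by apply: eq_bigr => i _; rewrite exprM.
Qed.

(** * Expanding the decorations by power sums *)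

Fixpoint cablings (p : nat) (w : diagram) (ks : seq nat) (T : nat -> annular) :
    seq diagram :=
  if ks is k :: ks' then
    flatten [seq cablings p w ks'
                   (fun l => if l == k then A_ i (p - 1 - i)%N else T l)
               | i <- iota 0 p]
  else [:: decorate w T].

Lemma linear_extension_P (H : diagram -> K) p w ks T :
  linear_extension H (decorate_rec w (fun=> P_ p) ks T) =
  (z / br p) ^+ size ks * \sum_(D <- cablings p w ks T) H D.
Proof.
elim: ks T => [|k ks IHks] T.
  by rewrite /linear_extension /= !big_seq1.
rewrite /linear_extension /= !big_flatten /= !big_map exprS mulr_sumr.
apply: eq_bigr => i _; rewrite big_map -mulrA -IHks mulr_sumr.
by apply: eq_bigr => b _; rewrite mulrA.
Qed.

Definition all_cablings (p : nat) (w : diagram) : seq diagram :=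
  cablings p w (components w) (fun=> Annular [::] [::]).

(** All terms of [P_ p] have the same coefficient [z / br p], so the normalization by [br p] cancels
    the denominators and leaves one [z] per component. *)
Lemma Zcheck_cablings (H : diagram -> K) p w : (0 < p)%N ->
  Zcheck H p w =
  z ^+ size (components w) * \sum_(D <- all_cablings p w) H D.
Proof.
move=> p0; rewrite /Zcheck linear_extension_P mulrA -exprMn.
by rewrite [br p * _]mulrC divfK ?br_neq0.
Qed.

(* Any choice of signs would do; this one matches the signs of the crossings
   between the cables, which keeps the elements of the Hecke algebra sparse. *)
Definition block_sign (p m : nat) : bool := ~~ (p <= m < p.*2)%N.

Definition total (p : nat) (w : diagram) : coef :=
  foldr cadd [::]
    [seq @evaluate (block_sign p) 0 [:: [:: Zpos xH]] D
       | D <- all_cablings p w].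

(** Used with [n = 3 * p]: each of the three links is drawn with three caps and each cap is replaced
    by [p], so one power of [t * z] clears all values. *)
Definition closes_in (n : nat) (D : diagram) : bool :=
  admissible 0 D && (count is_cap D == n).

Lemma Zcheck_total (H : diagram -> K) n p w : framed_homfly H -> (0 < p)%N ->
    all (closes_in n) (all_cablings p w) ->
  Zcheck H p w * (t * z) ^+ n = z ^+ size (components w) * cval z t (total p w).
Proof.
move=> hH p0 adm; rewrite Zcheck_cablings // -mulrA; congr (_ * _).
rewrite /total; elim: (all_cablings p w) adm => [|D Ds IH] /=.
  by rewrite big_nil mul0r.
case/andP=> /andP[admD /eqP capD] admDs.
rewrite big_cons mulrDl IH // -{1}capD cval_add.
by rewrite (homfly_evaluate hH (block_sign p)).
Qed.

(** * Divisibility certificates *)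

Definition defect (p : nat) : coef :=
  cadd (cadd (total p figure_eight) (copp (total p unknot_two_negative_kinks)))
    (signed (~~ odd p) (cmulz (total p torus_link_positive_kink))).

Definition mul_z2D (k : nat) (c : coef) : coef :=
  cadd (cmulz (cmulz c)) (iter k (cadd c) [::]).

Definition is_zero (c : coef) : bool := all (all (Z.eqb Z0)) c.

(* The coefficients of c are polynomials in z ^+ 2, not in z as in [coef]
   elsewhere. *)
Definition certificate (p : nat) (ks : seq nat) (c : coef) : bool :=
  [&& all (closes_in (3 * p)) (all_cablings p figure_eight),
      all (closes_in (3 * p)) (all_cablings p unknot_two_negative_kinks),
      all (closes_in (3 * p)) (all_cablings p torus_link_positive_kink) &
      is_zero (cadd (defect p) (copp
        (iter (3 * p).-1 cmulz (foldr mul_z2D (map (spread Z0) c) ks))))]%N.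

Lemma cval_is_zero (R : comPzRingType) (x y : R) c :
  is_zero c -> cval x y c = 0.
Proof.
elim: c => //= s c IHc /andP[s0 c0].
rewrite /cval /= -/(cval x y c) IHc // mulr0 addr0.
elim: s s0 => //= -[|a|a] s IHs //= s0.
by rewrite /zval /= -/(zval x s) IHs // mulr0 addr0.
Qed.

Lemma cval_mul_z2D (R : comPzRingType) (x y : R) k c :
  cval x y (mul_z2D k c) = (x ^+ 2 + k%:R) * cval x y c.
Proof.
have cval_iter : cval x y (iter k (cadd c) [::]) = k%:R * cval x y c.
  elim: k => [|k IHk]; first by rewrite mul0r.
  by rewrite iterS cval_add IHk mulrS mulrDl mul1r.
by rewrite cval_add cval_iter !cval_mulz mulrDl expr2 mulrA.
Qed.

Lemma cval_iter_mulz (R : comPzRingType) (x y : R) m c :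
  cval x y (iter m cmulz c) = x ^+ m * cval x y c.
Proof.
by elim: m => [|m IHm]; rewrite ?mul1r // iterS cval_mulz IHm exprS mulrA.
Qed.

Lemma cval_foldr_mul_z2D (R : comPzRingType) (x y : R) ks c :
  cval x y (foldr mul_z2D c ks) =
  (\prod_(k <- ks) (x ^+ 2 + k%:R)) * cval x y c.
Proof.
elim: ks => [|k ks IHks]; first by rewrite big_nil mul1r.
by rewrite /= cval_mul_z2D IHks big_cons mulrA.
Qed.

Lemma cval_spread (R : comPzRingType) (x y : R) c :
  cval x y (map (spread Z0) c) =
  horner_with (zval (x ^+ 2)) y (spread [::] c).
Proof.
rewrite horner_with_spread // /cval; elim: c => //= s c ->.
by rewrite /zval horner_with_spread.
Qed.

(** Here [x] is z and [y] is t. The knots carry one prefactor [x] and the two-component link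
    [x ^+ 2]; taking out a common [x] leaves [x * c] in the hypothesis and lowers the exponent to
    [n.-1]. *)
Lemma clear_certificate (F : fieldType) (x y A B C Q a b c d s : F) n :
    (0 < n)%N -> x != 0 -> Q != 0 ->
    a - b + s * (x * c) = x ^+ n.-1 * (Q * d) ->
    A * (y * x) ^+ n = x ^+ 1 * a -> B * (y * x) ^+ n = x ^+ 1 * b ->
    C * (y * x) ^+ n = x ^+ 2 * c ->
  (A - B - - s * C) / Q * y ^+ n = d.
Proof.
case: n => // n _ x0 Q0 /= E EA EB EC.
apply: (mulfI (expf_neq0 n.+1 x0)); apply: (mulfI Q0).
transitivity ((A - B + s * C) * (y * x) ^+ n.+1).
  by rewrite exprMn; field.
rewrite mulrDl mulrBl EA EB -mulrA EC.
by rewrite [in RHS]mulrCA [in RHS]exprS -[in RHS]mulrA -E; ring.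
Qed.

Lemma qint_neq0 p : (0 < p)%N -> qint p ^+ 2 != 0.
Proof. by move=> p0; rewrite expf_neq0 // mulf_neq0 ?invr_eq0 // br_neq0. Qed.

(** Row j is the coefficient of t^(2j), a polynomial in z^2. The list is the quotient of [defect 2]
    by z^5 (z^2 + 4), that is, t^6 times the element whose integrality is claimed. *)
Definition quotient2 : seq (seq int) :=
 [:: [::];
     [:: 2; 4; 1];
     [:: -4; -4; -1];
     [:: 1];
     [:: 4; 4; 1];
     [:: -5; -5; -1];
     [:: 2; 1]]%Z.

Lemma certificate2 : certificate 2 [:: 4]%N (map (map Z_of_int) quotient2).
Proof. by vm_compute. Qed.

(** Likewise the quotient of [defect 3] by z^8 (z^2 + 3)^2, that is, t^9 times the element in
    question. *)
Definition quotient3 : seq (seq int) :=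
 [:: [::];
     [:: 7; 36; 56; 36; 10; 1];
     [:: -20; -92; -133; -80; -21; -2];
     [:: 18; 77; 98; 52; 12; 1];
     [:: -2; -21; -30; -14; -2];
     [:: 1; 20; 30; 14; 2];
     [:: -18; -77; -98; -52; -12; -1];
     [:: 24; 102; 139; 81; 21; 2];
     [:: -12; -56; -77; -44; -11; -1];
     [:: 2; 11; 15; 7; 1]]%Z.

Lemma certificate3 : certificate 3 [:: 3; 3]%N (map (map Z_of_int) quotient3).
Proof. by vm_compute. Qed.

Lemma congr_mod_certificate (H : diagram -> K) p ks c :
    framed_homfly H -> (0 < p)%N ->
    qint p ^+ 2 = \prod_(k <- ks) (z ^+ 2 + k%:R) ->
    certificate p ks c ->
  congr_mod (Zcheck H p figure_eight - Zcheck H p unknot_two_negative_kinks)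
            ((-1) ^+ (p - 1)%N * Zcheck H p torus_link_positive_kink)
            (qint p ^+ 2).
Proof.
move=> hH p0 qp /and4P[adm4 admU admT /cval_is_zero].
move=> /(_ K z t); rewrite cval_add cval_opp => /subr0_eq.
rewrite cval_iter_mulz cval_foldr_mul_z2D -qp cval_spread.
rewrite /defect cval_add cval_add cval_opp cval_signed cval_mulz => E.
(* The factor z^(3p) is divided out, leaving t^(3p) to clear; [spread] passes from powers of t^2 to
   powers of t. *)
apply: (@in_Zz2t_horner _ (3 * p) (spread [::] c)).
have Z4 := Zcheck_total hH p0 adm4; have ZU := Zcheck_total hH p0 admU.
have ZT := Zcheck_total hH p0 admT.
have c4 : size (components figure_eight) = 1%N by [].
have cU : size (components unknot_two_negative_kinks) = 1%N by [].
have cT : size (components torus_link_positive_kink) = 2%N by [].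
rewrite c4 in Z4; rewrite cU in ZU; rewrite cT in ZT.
have sign : (-1) ^+ (p - 1) = - (if ~~ odd p then 1 else -1) :> K.
  case: p p0 {E Z4 ZU ZT adm4 admU admT qp} => // p _.
  by rewrite subn1 /= negbK -signr_odd; case: (odd p); rewrite ?opprK.
have n0 : (0 < 3 * p)%N by rewrite muln_gt0.
rewrite sign; exact: (clear_certificate n0 z_neq0 (qint_neq0 p0) E Z4 ZU ZT).
Qed.

(** The quotient is [x + x^-1], which is not a polynomial in [x - x^-1], though its square is; so
    {2}^2 is treated as a single factor, while {3} itself is z^2 + 3. *)
Lemma quantum2_sq (F : fieldType) (x : F) : x != 0 -> x - x^-1 != 0 ->
  ((x ^+ 2 - x ^- 2) / (x - x^-1)) ^+ 2 = (x - x^-1) ^+ 2 + 4%:R.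
Proof.
move=> x0 y0.
have -> : x ^+ 2 - x ^- 2 = (x + x^-1) * (x - x^-1) by field.
by rewrite mulfK //; field.
Qed.

Lemma quantum3 (F : fieldType) (x : F) : x != 0 -> x - x^-1 != 0 ->
  (x ^+ 3 - x ^- 3) / (x - x^-1) = (x - x^-1) ^+ 2 + 3%:R.
Proof.
move=> x0 y0.
have -> : x ^+ 3 - x ^- 3 = (x ^+ 2 + 1 + x ^- 2) * (x - x^-1) by field.
by rewrite mulfK //; field.
Qed.

Lemma qint2_sq : qint 2 ^+ 2 = \prod_(k <- [:: 4]) (z ^+ 2 + k%:R).
Proof.
by rewrite big_seq1 /qint br1; apply: quantum2_sq q_neq0 z_neq0.
Qed.

Lemma qint3_sq : qint 3 ^+ 2 = \prod_(k <- [:: 3; 3]) (z ^+ 2 + k%:R).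
Proof.
rewrite big_cons big_seq1 -expr2 /qint br1; congr (_ ^+ 2).
exact: quantum3 q_neq0 z_neq0.
Qed.

Theorem theorem1p7 (H : diagram -> K) (hH : framed_homfly H) (p : nat)
    (hp : p = 2%N \/ p = 3%N) :
  congr_mod (Zcheck H p figure_eight - Zcheck H p unknot_two_negative_kinks)
            ((-1) ^+ (p - 1)%N * Zcheck H p torus_link_positive_kink)
            (qint p ^+ 2).
Proof.
case: hp => ->.
  by apply: (congr_mod_certificate hH _ qint2_sq certificate2).
by apply: (congr_mod_certificate hH _ qint3_sq certificate3).
Qed.
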